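(* For every function $f\colon\mathbb{R}^2\to\mathbb{R}$, the set $VFC(f)$ is densely nonmeager, that is, its intersection with every box $(\alpha,\beta)\times(\gamma,\delta)$ (with $\alpha<\beta$, $\gamma<\delta$) is nonmeager in $\mathbb{R}^2$.
   Context: Notation: $x_n\searrow x$ means that $(x_n)$ is a strictly decreasing sequence of reals converging to $x$. A function $f\colon\mathbb{R}^2\to\mathbb{R}$ is very feebly continuous at $\langle x,y\rangle$ if there exist a sequence $x_n\searrow x$ and, for each $n\in\mathbb{N}$, a sequence $y^{(n)}_m\searrow y$ (as $m\to\infty$) such that $\lim_{n\to\infty}\lim_{m\to\infty}f(x_n,y^{(n)}_m)=f(x,y)$ (the inner limit exists in $\mathbb{R}$ for each $n$, and the outer limit exists). $VFC(f)$ denotes the set of all points of $\mathbb{R}^2$ at which $f$ is very feebly continuous. *)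

(* Defs.v *)
From mathcomp Require Import all_boot all_order all_algebra.
From mathcomp Require Import all_classical all_reals all_analysis.
Import Order.TTheory GRing.Theory Num.Theory.
Import numFieldNormedType.Exports.

Set Implicit Arguments.
Unset Strict Implicit.
Unset Printing Implicit Defensive.

Local Open Scope classical_set_scope.
Local Open Scope ring_scope.

Definition nowhere_dense (T : topologicalType) (A : set T) : Prop :=
  interior (closure A) = set0.

Definition meager (T : topologicalType) (A : set T) : Prop :=
  exists F : nat -> set T,
    (forall n, nowhere_dense (F n)) /\ A = \bigcup_n F n.

(* [decreasing_seq] is the library's strict monotonicity:
   n <= m if and only if u m <= u n. *)
Definition decreases_to (R : realType) (u : nat -> R) (x : R) : Prop :=
  decreasing_seq u /\ u n @[n --> \oo] --> x.

(* [l n] is the inner limit, as m tends to infinity, of f (x_n, y^(n)_m). *)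
Definition very_feebly_continuous_at (R : realType) (f : R * R -> R)
    (p : R * R) : Prop :=
  exists (x : nat -> R) (y : nat -> nat -> R) (l : nat -> R),
    [/\ decreases_to x p.1,
        forall n, decreases_to (y n) p.2,
        forall n, f (x n, y n m) @[m --> \oo] --> l n
      & l n @[n --> \oo] --> f p].

Definition VFC (R : realType) (f : R * R -> R) : set (R * R) :=
  [set p | very_feebly_continuous_at f p].

Definition densely_nonmeager (R : realType) (A : set (R * R)) : Prop :=
  forall a b c d : R, a < b -> c < d ->
    ~ meager (A `&` (`]a, b[ `*` `]c, d[)).

(* Main.v *)
Require Import Defs.
From mathcomp Require Import all_boot all_order all_algebra.
From mathcomp Require Import all_classical all_reals all_analysis.
From mathcomp Require Import lra.
Import Order.TTheory GRing.Theory Num.Theory.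
Import numFieldNormedType.Exports.

(** A point p fails to be very feebly continuous exactly because of some closed
    interval J with rational endpoints, containing f p in its interior, and some
    k: on each vertical line at abscissa x in (p.1, p.1 + 1/(k+1)), f avoids J
    on a right neighbourhood of p.2. (Compactness of J turns the lack of a
    limit value of f (x, -) in J from the right at p.2 into this avoidance.)
    So the complement of VFC f is covered by the countably many sets
    A = [right_avoiding f (J, k)] ([setC_VFC_sub]).

    None of these sets need be meager, but few of their vertical sections are
    dense anywhere. Let x < x' < x + 1/(k+1) and suppose that the sections of A
    at x and x' are both dense in an interval V. A point y of V in the section
    at x has f (x', -) outside J just to the right of y, while the section at
    x', on which f (x', -) lies in J, is dense there: contradiction. Hence the
    abscissae whose section is dense in V are at mutual distance at least
    1/(k+1), so they form a nowhere dense set ([right_avoiding_sections]).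

    Suppose that VFC f is meager in a box, covered there by nowhere dense sets
    F n. By the easy half of the Kuratowski-Ulam theorem
    ([nowhere_dense_sections]), the abscissae at which the section of the
    closure of F n contains a given rational interval form a nowhere dense set.
    The Baire category theorem then yields one abscissa x in the box at which
    the sections of the F n and of all the sets A are nowhere dense. They cover
    the side of the box on that vertical line, which contradicts the Baire
    category theorem again. *)

Set Implicit Arguments.
Unset Strict Implicit.
Unset Printing Implicit Defensive.

Local Open Scope classical_set_scope.
Local Open Scope ring_scope.

(** * Limit values from the right *)

Lemma decreases_to_exists (R : realType) (x : R) (P : nat -> R -> Prop) :
  (forall n e, 0 < e -> exists t, x < t < x + e /\ P n t) ->
  exists u, decreases_to u x /\ forall n, P n (u n).
Proof.
move=> exP.
have /choice[g gP] (ne : nat * R) :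
    exists t, 0 < ne.2 -> x < t < x + ne.2 /\ P ne.1 t.
  have [/(exP ne.1)[t ?]|_] := ltP 0 ne.2; last by exists 0.
  by exists t.
(* Capping the step at u m - x keeps the sequence strictly decreasing, and
   capping it at 1/(m+2) makes it converge to x. *)
pose u := fix u n := if n is m.+1
  then g (m.+1, Num.min (u m - x) m.+2%:R^-1) else g (0%N, 1).
have uP n : x < u n < x + n.+1%:R^-1 /\ P n (u n).
  elim: n => [|n [/andP[xu _] _]].
    by rewrite invr1; apply: (gP (0%N, 1)).
  have [|/andP[lt1 lt2] Pu] := gP (n.+1, Num.min (u n - x) n.+2%:R^-1).
    by rewrite /= lt_min subr_gt0 xu /= invr_gt0 ltr0n.
  split=> //=; rewrite lt1 /= (lt_le_trans lt2) //=.
  by rewrite lerD2l ge_min lexx orbT.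
exists u; split; last by move=> n; have [] := uP n.
split.
  apply/decreasing_seqP => n; have [/andP[xu _] _] := uP n.
  have [|/andP[_ lt2] _] := gP (n.+1, Num.min (u n - x) n.+2%:R^-1).
    by rewrite /= lt_min subr_gt0 xu /= invr_gt0 ltr0n.
  by apply: (lt_le_trans lt2) => /=; rewrite -lerBrDl ge_min lexx.
apply: (squeeze_cvgr (f := fun=> x) (h := fun n => x + harmonic n)).
- by apply: nearW => n; have [/andP[/ltW -> /ltW ->]] := uP n.
- exact: cvg_cst.
- rewrite -[X in _ --> X]addr0.
  by apply: cvgD; [exact: cvg_cst|exact: cvg_harmonic].
Qed.

Definition right_cluster_value (R : realType) (g : R -> R) (y l : R) : Prop :=
  forall e eta, 0 < e -> 0 < eta ->
  exists y', y < y' < y + eta /\ `|g y' - l| < e.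

(** The images of the sets (y, y + eta) `&` g @^-1` [a, b] form a filter base on
    the compact segment [a, b]; a cluster point of it is the required value. *)
Lemma right_cluster_value_in_segment (R : realType) (g : R -> R) (y a b : R) :
  (forall eta, 0 < eta -> exists y', y < y' < y + eta /\ a <= g y' <= b) ->
  exists l, a <= l <= b /\ right_cluster_value g y l.
Proof.
move=> gy.
pose B eta := [set g y' | y' in [set y' | y < y' < y + eta /\ a <= g y' <= b]].
pose F := filter_from [set eta : R | 0 < eta] B.
have FP : ProperFilter F.
  apply: filter_from_proper => [|eta eta0].
    apply: filter_from_filter; first by exists 1 => /=.
    move=> e1 e2 /= e10 e20; exists (Num.min e1 e2) => /=.
      by rewrite lt_min e10 e20.
    move=> _ [y' [/andP[yy' y'e] gy'] <-].
    move: y'e; rewrite -ltrBlDl lt_min => /andP[y'1 y'2].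
    by split; exists y' => //; split=> //; rewrite yy' -ltrBlDl.
  by have [y' ?] := gy eta eta0; exists (g y'), y'.
have FJ : F `[a, b]%classic.
  by exists 1 => //= _ [y' [_ gy'] <-]; rewrite /= in_itv.
have [l [/= lab Fl]] := segment_compact FP FJ.
exists l; split; first by move: lab; rewrite in_itv.
move=> e eta e0 eta0.
have FB : F (B eta) by exists eta.
have [_ [[y' [yy' _] <-] ley']] := Fl _ _ FB (nbhsx_ballx l e e0).
by exists y'; split=> //; rewrite distrC.
Qed.

(** This replaces the sequences in the definition of very feeble continuity by
    a condition without sequences, which is the one that can be negated. *)
Lemma VFC_of_right_cluster_values (R : realType) (f : R * R -> R) (p : R * R) :
  (forall e d, 0 < e -> 0 < d -> exists x l,
    [/\ p.1 < x < p.1 + d, `|l - f p| < e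
      & right_cluster_value (fun y => f (x, y)) p.2 l]) ->
  very_feebly_continuous_at f p.
Proof.
move=> fp.
have [x [xp xP]] : exists x, decreases_to x p.1 /\ forall n,
    exists l, `|l - f p| < n.+1%:R^-1 /\
      right_cluster_value (fun y => f (x n, y)) p.2 l.
  apply: (decreases_to_exists (P := fun n x => exists l,
    `|l - f p| < n.+1%:R^-1 /\ right_cluster_value (fun y => f (x, y)) p.2 l)).
  move=> n d d0; have [|x [l [? ? ?]]] := fp n.+1%:R^-1 d _ d0.
    by rewrite invr_gt0 ltr0n.
  by exists x; split=> //; exists l.
have [l lP] := choice xP.
have cvg_within_inv (u : nat -> R) (v : R) :
    (forall n, `|u n - v| < n.+1%:R^-1) -> u n @[n --> \oo] --> v.
  move=> uv; apply/cvgrPdist_lt => e e0.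
  near=> n; rewrite distrC (lt_trans (uv n)) //.
  by near: n; exact: (near_infty_natSinv_lt (PosNum e0)).
have /choice[y yP] n : exists y, decreases_to y p.2 /\
    forall m, `|f (x n, y m) - l n| < m.+1%:R^-1.
  apply: (decreases_to_exists
    (P := fun m y => `|f (x n, y) - l n| < m.+1%:R^-1)).
  by move=> m eta eta0; apply: (lP n).2 => //; rewrite invr_gt0 ltr0n.
exists x, y, l; split=> //.
- by move=> n; have [] := yP n.
- by move=> n; apply: cvg_within_inv; have [] := yP n.
- by apply: cvg_within_inv => n; have [] := lP n.
Unshelve. all: by end_near. Qed.

(** The index i encodes the closed interval [i.1.1, i.1.2] and the width
    1/(i.2 + 1); rational endpoints leave only countably many such sets. *)
Definition right_avoiding (R : realType) (f : R * R -> R)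
    (i : rat * rat * nat) : set (R * R) :=
  [set p | ratr i.1.1 <= f p <= ratr i.1.2 /\
    forall x, p.1 < x < p.1 + i.2.+1%:R^-1 -> exists2 eta, 0 < eta &
    forall y, p.2 < y < p.2 + eta -> ~ ratr i.1.1 <= f (x, y) <= ratr i.1.2].

Lemma setC_VFC_sub (R : realType) (f : R * R -> R) (p : R * R) :
  ~ VFC f p -> exists i, right_avoiding f i p.
Proof.
apply: contra_notP => /forallNP avoidN; apply: VFC_of_right_cluster_values.
move=> e d e0 d0.
have [q1] : exists q : rat, ratr q \in `]f p - e, f p[.
  by apply: rat_in_itvoo; rewrite ltrBlDr ltrDl.
rewrite in_itv /= => /andP[q1l q1r].
have [q2] : exists q : rat, ratr q \in `]f p, f p + e[.
  by apply: rat_in_itvoo; rewrite ltrDl.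
rewrite in_itv /= => /andP[q2l q2r].
have [k _ /(_ _ (leqnn k)) /= kd] := near_infty_natSinv_lt (PosNum d0).
apply: contrapT => noxl; apply: (avoidN (q1, q2, k)); split=> /=.
  by rewrite !ltW.
move=> x /andP[px xk]; apply: contrapT => noeta.
have [eta eta0|l [/andP[l1 l2] lP]] := @right_cluster_value_in_segment _
    (fun y => f (x, y)) p.2 (ratr q1) (ratr q2).
  apply: contrapT => noy; apply: noeta; exists eta => // y yeta fxy.
  by apply: noy; exists y.
apply: noxl; exists x, l; split=> //.
  by rewrite px (lt_trans xk) // ltrD2l.
rewrite distrC ltr_distlC; apply/andP; split; lra.
Qed.

(** * Category on the line *)

Lemma nowhere_dense_itvP (R : realType) (A : set R) :
  nowhere_dense A <-> forall a b : R, a < b -> ~ `]a, b[ `<=` closure A.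
Proof.
split=> [Ad a b ab abA|AN].
  have := abA; rewrite open_subsetE; last exact: itv_open.
  rewrite Ad => /(_ ((a + b) / 2)); apply; rewrite /= in_itv /=.
  by rewrite !midf_lt.
apply/seteqP; split=> // x Ax.
have /nbhs_ballP[e /= e0 xe] : nbhs x (closure A) by [].
apply: (AN (x - e) (x + e)); first by lra.
by move=> y ye; apply: xe; rewrite ball_itv.
Qed.

Lemma dense_in_itv_meets (R : realType) (A : set R) (a b u v : R) :
  `]a, b[ `<=` closure A -> a <= u -> u < v -> v <= b ->
  exists2 x, A x & u < x < v.
Proof.
move=> abA au uv vb.
have [||x [Ax]] := abA ((u + v) / 2) _ `]u, v[%classic.
- by rewrite /= in_itv /=; apply/andP; split; lra.
- by apply: near_in_itvoo; rewrite in_itv /= !midf_lt.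
- by rewrite /= in_itv; exists x.
Qed.

Lemma nowhere_dense_ratP (R : realType) (A : set R) :
  (forall p q : rat, p < q -> ~ `](ratr p : R), ratr q[ `<=` closure A) ->
  nowhere_dense A.
Proof.
move=> AN; apply/nowhere_dense_itvP => a b ab abA.
have [p /[!in_itv]/= /andP[ap pb]] := rat_in_itvoo ab.
have [q /[!in_itv]/= /andP[pq qb]] := rat_in_itvoo pb.
apply: (AN p q); first by rewrite -(ltr_rat R).
apply: subset_trans abA => x /=; rewrite !in_itv /= => /andP[px xq].
by rewrite (lt_trans ap px) (lt_trans xq qb).
Qed.

(** Indexing by an arbitrary countable type lets the two families of
    exceptional sets in the main proof be avoided at once. *)
Lemma Baire_itv (R : realType) (I : countType) (F : I -> set R) (a b : R) :
  a < b -> (forall i, nowhere_dense (F i)) ->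
  exists2 x, a < x < b & forall i, ~ F i x.
Proof.
move=> ab Fd.
pose G n : set R := if unpickle n is Some i then ~` closure (F i) else setT.
have GP n : open (G n) /\ dense (G n).
  rewrite /G; case: unpickle => [i|]; last first.
    split; first exact: openT.
    by move=> O O0 _; rewrite setIT.
  split; first by rewrite openC; exact: closed_closure.
  move=> O O0 Oo; apply: contrapT => /nonemptyPn/disjoints_subset.
  rewrite setCK open_subsetE// Fd subset0 => OE.
  by move: O0; rewrite OE => -[].
have [||x [/= xab xG]] := @Baire _ _ G GP `]a, b[%classic.
- by exists ((a + b) / 2); rewrite /= in_itv /= !midf_lt.
- exact: itv_open.
exists x; first by move: xab; rewrite in_itv.
move=> i Fix; have := xG (pickle i) Logic.I; rewrite /G pickleK; apply.
exact: subset_closure.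
Qed.

(** * Sections of planar sets *)

Lemma closed_vertical_section (T U : topologicalType) (C : set (T * U))
    (x : T) :
  closed C -> closed [set y | C (x, y)].
Proof.
move=> Cc; apply: (@preimage_closed _ _ (pair x) C) => // z _.
rewrite /prop_for /continuous_at.
by apply: (cvg_pair (G := nbhs x) (H := nbhs z));
  [exact: cvg_cst|exact: cvg_id].
Qed.

Lemma closed_horizontal_section (T U : topologicalType) (C : set (T * U))
    (y : U) :
  closed C -> closed [set x | C (x, y)].
Proof.
move=> Cc; apply: (@preimage_closed _ _ (fun x => (x, y)) C) => // z _.
rewrite /prop_for /continuous_at.
by apply: (cvg_pair (G := nbhs z) (H := nbhs y));
  [exact: cvg_id|exact: cvg_cst].
Qed.

(** The set is closed, as an intersection of horizontal sections of closure F;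
    if it contained an interval, closure F would contain a box. *)
Lemma nowhere_dense_sections (R : realType) (F : set (R * R)) (c d : R) :
  nowhere_dense F -> c < d ->
  nowhere_dense [set x | `]c, d[ `<=` [set y | closure F (x, y)]].
Proof.
move=> Fd cd; apply/nowhere_dense_itvP => a b ab abF.
suff boxF : `]a, b[ `*` `]c, d[ `<=` closure F.
  suff : interior (closure F) ((a + b) / 2, (c + d) / 2) by rewrite Fd.
  apply: filterS boxF _; exists (`]a, b[%classic, `]c, d[%classic) => //=.
  by split; apply: open_nbhs_nbhs; (split; first exact: itv_open);
    rewrite /= in_itv /= !midf_lt.
move=> [x y] [/= xab ycd].
apply: (closed_horizontal_section (@closed_closure _ F) (y := y) (t := x)).
apply: closureS (abF _ xab) => z /= /(_ y); exact.
Qed.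

(** An interval of length at most d inside which X is dense would contain a
    point of X in each of its two halves. *)
Lemma separated_nowhere_dense (R : realType) (X : set R) (d : R) :
  0 < d -> (forall x x', X x -> X x' -> ~ x < x' < x + d) ->
  nowhere_dense X.
Proof.
move=> d0 Xd; apply/nowhere_dense_itvP => a b ab abX.
pose m := Num.min b (a + d).
have [am mb md] : [/\ a < m, m <= b & m <= a + d].
  by rewrite /m lt_min ge_min lexx ab ge_min lexx orbT ltrDl.
have [||//|x Xx /andP[ax xm]] :=
  dense_in_itv_meets (u := a) (v := (a + m) / 2) abX; [by []|lra|lra|].
have [||//|x' Xx' /andP[mx' x'm]] :=
  dense_in_itv_meets (u := (a + m) / 2) (v := m) abX; [lra|lra|].
apply: (Xd x x') => //; apply/andP; split; lra.
Qed.

(** Two points x < x' of this set cannot be closer than the width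
    1/(i.2 + 1): a point (x, y) of the avoiding set forces a gap just above y in
    the section at x', which is dense there. *)
Lemma right_avoiding_sections (R : realType) (f : R * R -> R) i (c d : R) :
  c < d ->
  nowhere_dense
    [set x | `]c, d[ `<=` closure [set y | right_avoiding f i (x, y)]].
Proof.
move=> cd; apply: (@separated_nowhere_dense _ _ i.2.+1%:R^-1).
  by rewrite invr_gt0 ltr0n.
move=> x x' xdense x'dense xx'.
have [y [_ /(_ x' xx')[eta eta0 /= yavoid]] /andP[cy yd]] :=
  dense_in_itv_meets xdense (lexx c) cd (lexx d).
have [|||y' [/= fy' _] /andP[yy' ]] :=
  dense_in_itv_meets (u := y) (v := Num.min d (y + eta)) x'dense.
- exact: ltW.
- by rewrite lt_min yd ltrDl.
- by rewrite ge_min lexx.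
rewrite lt_min => /andP[_ y'eta]; apply: (yavoid y') fy'.
by rewrite yy'.
Qed.

Theorem theorem4 (R : realType) (f : (R * R)%type -> R) :
  densely_nonmeager (VFC f).
Proof.
move=> a b c d ab cd [F [Fd VF]].
(* The abscissae to avoid are those at which the section of some closure (F n)
   or of some avoiding set is dense in some rational interval. *)
pose Irat := {pq : rat * rat | pq.1 < pq.2}.
pose V (k : Irat) : set R := `]ratr (val k).1, ratr (val k).2[%classic.
have Vlt (k : Irat) : ratr (val k).1 < ratr (val k).2 :> R.
  by rewrite ltr_rat; exact: (valP k).
pose bad (j : Irat * (nat + (rat * rat * nat))) : set R := match j.2 with
  | inl n => [set x | V j.1 `<=` [set y | closure (F n) (x, y)]]
  | inr i => [set x | V j.1 `<=` closure [set y | right_avoiding f i (x, y)]]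
  end.
have [[k [n|i]]|x xab xgood] := @Baire_itv _ _ bad a b ab.
- exact: nowhere_dense_sections.
- exact: right_avoiding_sections.
(* On the vertical line at x, these nowhere dense sets cover (c, d). *)
pose slice (j : nat + rat * rat * nat) : set R := match j with
  | inl n => [set y | closure (F n) (x, y)]
  | inr i => [set y | right_avoiding f i (x, y)]
  end.
have [j|y ycd ygood] := @Baire_itv _ _ slice c d cd.
  apply: nowhere_dense_ratP => p q pq pqj.
  apply: (xgood (exist _ (p, q) pq, j)); case: j pqj => [n|i] //= pqn.
  apply: subset_trans pqn _ => y.
  exact: (closed_vertical_section (@closed_closure _ (F n)) (x := x) (t := y)).
have [VFCxy|/setC_VFC_sub[i]] := pselect (VFC f (x, y)); last first.
  exact: (ygood (inr i)).
have : (VFC f `&` (`]a, b[ `*` `]c, d[)) (x, y).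
  by split=> //; split; rewrite /= in_itv.
by rewrite VF => -[n _ /subset_closure]; exact: (ygood (inl n)).
Qed.
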